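(* Consider the nonlinear system $x_{k+1}=f(x_k,u_k)$, $y_k=g(x_k,u_k)$ and assume it admits a Koopman linear embedding $z_{k+1}=Az_k+Bu_k$, $y_k=Cz_k+Du_k$ with lifted state $z_k=\Phi(x_k)\in\mathbb{R}^{n_z}$. Let $\mathcal{B}_1|_L$ and $\mathcal{B}_2|_L$ be the sets of length-$L$ input-output trajectories of the nonlinear system and of the Koopman linear embedding, respectively. Then: 1. $\mathcal{B}_1|_L\subseteq\mathcal{B}_2|_L$ for all $L\ge 1$; i.e., all trajectories of the nonlinear system are also trajectories of the Koopman linear embedding. 2. Let $\mathrm{col}(u,y)\in\mathcal{B}_2|_L$, where $L>n_z$. Then $\mathrm{col}(u,y)\in\mathcal{B}_1|_L$ if and only if its leading sequence of length $n_z$ is a valid trajectory of the nonlinear system, i.e., $\mathrm{col}(u_{0:n_z-1},y_{0:n_z-1})\in\mathcal{B}_1|_{n_z}$.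
   Context: Nonlinear system: $f:\mathbb{R}^n\times\mathbb{R}^m\to\mathbb{R}^n$, $g:\mathbb{R}^n\times\mathbb{R}^m\to\mathbb{R}^p$ are given; $x_k\in\mathbb{R}^n$, $u_k\in\mathbb{R}^m$, $y_k\in\mathbb{R}^p$ are state, input and output at time $k$. Koopman linear embedding: the nonlinear system admits a Koopman linear embedding if there exist linearly independent lifting functions $\phi_1,\dots,\phi_{n_z}:\mathbb{R}^n\to\mathbb{R}$ such that $\Phi(x):=\mathrm{col}(\phi_1(x),\dots,\phi_{n_z}(x))\in\mathbb{R}^{n_z}$ propagates linearly along all trajectories of the system and the output is a linear map of $\Phi(x_k)$ and $u_k$; that is, there are real matrices $A\in\mathbb{R}^{n_z\times n_z}$, $B\in\mathbb{R}^{n_z\times m}$, $C\in\mathbb{R}^{p\times n_z}$, $D\in\mathbb{R}^{p\times m}$ with $\Phi(f(x,u))=A\Phi(x)+Bu$ and $g(x,u)=C\Phi(x)+Du$ for all $x\in\mathbb{R}^n$, $u\in\mathbb{R}^m$. The associated linear system $z_{k+1}=Az_k+Bu_k$, $y_k=Cz_k+Du_k$ (with arbitrary $z_0\in\mathbb{R}^{n_z}$) is also called the Koopman linear embedding; it need not be controllable or observable. Notation: $\mathrm{col}$ denotes vertical stacking. For $u=\mathrm{col}(u_0,\dots,u_{L-1})$, $u_{p:q}:=\mathrm{col}(u_p,\dots,u_q)$ (similarly for $y$). $\mathcal{B}_1|_L$ is the set of $\mathrm{col}(u,y)\in\mathbb{R}^{(m+p)L}$, with $u=\mathrm{col}(u_0,\dots,u_{L-1})$,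 $y=\mathrm{col}(y_0,\dots,y_{L-1})$, for which there exists an initial state $x_0\in\mathbb{R}^n$ such that the nonlinear system equations hold along the sequence. $\mathcal{B}_2|_L$ is the set of $\mathrm{col}(u,y)\in\mathbb{R}^{(m+p)L}$ for which there exists an initial state $z_0\in\mathbb{R}^{n_z}$ such that the linear system equations hold along the sequence. *)

(* Defs.v *)
From mathcomp Require Export all_boot all_order all_algebra.
From mathcomp Require Export classical_sets reals.

Set Implicit Arguments.
Unset Strict Implicit.
Unset Printing Implicit Defensive.

Local Open Scope classical_set_scope.
Local Open Scope ring_scope.

(* The trajectory vector col(u, y); its dimension (m + p) L appears as
   \sum_(i < L) m + \sum_(i < L) p, the form used by [\mxcol] and [col_mx]. *)
Definition traj_col (R : realType) (m p L : nat)
    (u : 'I_L -> 'cV[R]_m) (y : 'I_L -> 'cV[R]_p) :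
    'cV[R]_(\sum_(i < L) m + \sum_(i < L) p) :=
  col_mx (\mxcol_(i < L) u i) (\mxcol_(i < L) y i).

(* The leading subsequence s_{0:k-1} of a sequence of length L. *)
Definition leading (T : Type) (k L : nat) (kL : (k <= L)%N) (s : 'I_L -> T) :
    'I_k -> T :=
  fun i => s (widen_ord kL i).

(* The state sequence is indexed by nat, but only x 0, ..., x L are
   constrained. *)
Definition io_behavior (R : realType) (n m p : nat)
    (f : 'cV[R]_n -> 'cV[R]_m -> 'cV[R]_n)
    (g : 'cV[R]_n -> 'cV[R]_m -> 'cV[R]_p) (L : nat) :
    set 'cV[R]_(\sum_(i < L) m + \sum_(i < L) p) :=
  [set w | exists (u : 'I_L -> 'cV[R]_m) (y : 'I_L -> 'cV[R]_p),
     w = traj_col u y /\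
     exists (x0 : 'cV[R]_n) (x : nat -> 'cV[R]_n),
       x 0%N = x0 /\
       forall k : 'I_L, x k.+1 = f (x k) (u k) /\ y k = g (x k) (u k)].

Arguments io_behavior [R n m p] f g L _.

Definition linear_behavior (R : realType) (nz m p : nat)
    (A : 'M[R]_nz) (B : 'M[R]_(nz, m)) (C : 'M[R]_(p, nz)) (D : 'M[R]_(p, m))
    (L : nat) : set 'cV[R]_(\sum_(i < L) m + \sum_(i < L) p) :=
  io_behavior (fun z u => A *m z + B *m u) (fun z u => C *m z + D *m u) L.

Arguments linear_behavior [R nz m p] A B C D L _.

(* Stated directly because the space of all functions R^n -> R is not
   finite-dimensional, so that [free] does not apply. *)
Definition lin_indep_functions (R : realType) (n nz : nat)
    (phi : 'I_nz -> 'cV[R]_n -> R) : Prop :=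
  forall c : 'I_nz -> R,
    (forall x, \sum_(i < nz) c i * phi i x = 0) -> forall i, c i = 0.

Definition lift_map (R : realType) (n nz : nat)
    (phi : 'I_nz -> 'cV[R]_n -> R) (x : 'cV[R]_n) : 'cV[R]_nz :=
  \col_(i < nz) phi i x.

Definition koopman_linear_embedding (R : realType) (n m p nz : nat)
    (f : 'cV[R]_n -> 'cV[R]_m -> 'cV[R]_n)
    (g : 'cV[R]_n -> 'cV[R]_m -> 'cV[R]_p)
    (phi : 'I_nz -> 'cV[R]_n -> R)
    (A : 'M[R]_nz) (B : 'M[R]_(nz, m)) (C : 'M[R]_(p, nz)) (D : 'M[R]_(p, m))
    : Prop :=
  [/\ lin_indep_functions phi,
      forall x u, lift_map phi (f x u) = A *m lift_map phi x + B *m u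
    & forall x u, g x u = C *m lift_map phi x + D *m u].

(* Main.v *)
Require Import Defs.

(** The first claim is the defining property of the lifting: along a state
    trajectory [x] of the nonlinear system, [lift_map phi (x k)] is a state
    trajectory of the linear system with the same inputs and outputs.

    For the second claim, a trajectory of either system is cut down to its
    leading part by forgetting the rest.  For the converse, the nonlinear state
    that explains the leading part is propagated by [f] under the remaining
    inputs, and it has to be shown that the output so produced agrees with the
    given one, which comes from some linear state sequence [z].  Lift the
    nonlinear states: [lift_map phi (x k)] and [z k] are two solutions of the
    linear system with the same input, so their difference [d] solves the
    autonomous equation [d k.+1 = A *m d k], hence [d k = A ^ k *m d 0], and the
    two outputs differ by [C *m d k].  This difference vanishes for the first
    [nz] instants.  By Cayley-Hamilton every power of [A] is a combination of
    its first [nz] powers, so it vanishes at all later instants as well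
    ([autonomous_output_eq0]).  The states [z 0] and [lift_map phi (x 0)] may
    remain different: what the argument shows is that their difference is an
    unobservable state. *)

Local Open Scope classical_set_scope.
Local Open Scope ring_scope.

Import GRing.Theory.

(** Reducing ['X^k] modulo the characteristic polynomial does not change its
    value at [A] and leaves a polynomial of degree at most [n]. *)
Lemma expmx_lincomb {F : fieldType} {n : nat} (A : 'M[F]_n.+1) (k : nat) :
  exists c : nat -> F, A ^+ k = \sum_(i < n.+1) c i *: A ^+ i.
Proof.
pose r := 'X^k %% char_poly A.
have size_r : (size r <= n.+1)%N.
  by rewrite -ltnS -(size_char_poly A) ltn_modp monic_neq0 ?char_poly_monic.
exists (fun i => r`_i).
rewrite -[A in LHS]horner_mx_X -rmorphXn /=.
rewrite [X in horner_mx A X](divp_eq _ (char_poly A)) rmorphD rmorphM /=.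
rewrite Cayley_Hamilton mulr0 add0r -/r.
rewrite -[r in LHS](coefK r) (poly_def (size r)) rmorph_sum /=.
rewrite (big_ord_widen n.+1 (fun i => horner_mx A (r`_i *: 'X^i))) //.
rewrite big_mkcond; apply: eq_bigr => i _.
case: ltnP => [_|le_r_i]; last by rewrite nth_default ?scale0r.
by rewrite linearZ /= rmorphXn /= horner_mx_X.
Qed.

(** Only the first [L] steps are constrained, so that the lemma applies to the
    difference of two finite trajectories. *)
Lemma autonomous_output_eq0 {F : fieldType} {n p L : nat} {A : 'M[F]_n}
    {C : 'M[F]_(p, n)} {d : nat -> 'cV[F]_n} :
  (n <= L)%N ->
  (forall k, (k < L)%N -> d k.+1 = A *m d k) ->
  (forall k, (k < n)%N -> C *m d k = 0) ->
  forall k, (k <= L)%N -> C *m d k = 0.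
Proof.
(* Square matrices form a ring with powers only in positive dimension. *)
case: n => [|n] in A C d *; first by move=> _ _ _ k _; rewrite flatmx0 mulmx0.
move=> le_n_L dS Cd0 k le_k_L.
have d_exp j : (j <= L)%N -> d j = A ^+ j *m d 0%N.
  elim: j => [|j IHj] lt_j_L; first by rewrite expr0 mul1mx.
  by rewrite dS // IHj 1?ltnW // mulmxA exprS.
have [c Ak] := expmx_lincomb A k.
rewrite d_exp // Ak mulmx_suml mulmx_sumr big1 // => i _.
rewrite -scalemxAl -scalemxAr -d_exp ?Cd0 ?scaler0 //.
by rewrite (leq_trans _ le_n_L) // ltnW.
Qed.

Lemma traj_col_inj {R : realType} {m p L : nat}
    {u u' : 'I_L -> 'cV[R]_m} {y y' : 'I_L -> 'cV[R]_p} :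
  traj_col u y = traj_col u' y' -> u =1 u' /\ y =1 y'.
Proof. by case/eq_col_mx => /eq_mxcolP eq_u /eq_mxcolP eq_y. Qed.

(** Since a stacked vector determines its blocks, membership of
    [traj_col u y] constrains [u] and [y] themselves. *)
Lemma io_behavior_traj_colP {R : realType} {n m p : nat}
    {f : 'cV[R]_n -> 'cV[R]_m -> 'cV[R]_n}
    {g : 'cV[R]_n -> 'cV[R]_m -> 'cV[R]_p} {L : nat}
    {u : 'I_L -> 'cV[R]_m} {y : 'I_L -> 'cV[R]_p} :
  io_behavior f g L (traj_col u y) <->
  exists x : nat -> 'cV[R]_n,
    forall k : 'I_L, x k.+1 = f (x k) (u k) /\ y k = g (x k) (u k).
Proof.
split=> [[u' [y' [/traj_col_inj[eq_u eq_y] [_ [x [_ xP]]]]]]|[x xP]].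
  by exists x => k; rewrite eq_u eq_y.
by exists u, y; split=> //; exists (x 0%N), x.
Qed.

Lemma io_behavior_leading {R : realType} {n m p : nat}
    {f : 'cV[R]_n -> 'cV[R]_m -> 'cV[R]_n}
    {g : 'cV[R]_n -> 'cV[R]_m -> 'cV[R]_p} {k L : nat} (kL : (k <= L)%N)
    {u : 'I_L -> 'cV[R]_m} {y : 'I_L -> 'cV[R]_p} :
  io_behavior f g L (traj_col u y) ->
  io_behavior f g k (traj_col (leading kL u) (leading kL y)).
Proof.
move=> /io_behavior_traj_colP[x xP]; apply/io_behavior_traj_colP.
by exists x => i; exact: (xP (widen_ord kL i)).
Qed.

(** Nothing constrains a state trajectory of a leading part after its last
    instant; running the dynamics from its initial state under the whole input
    replaces it by one that is defined up to the final time. *)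
Lemma io_behavior_leading_extend {R : realType} {n m p : nat}
    {f : 'cV[R]_n -> 'cV[R]_m -> 'cV[R]_n}
    {g : 'cV[R]_n -> 'cV[R]_m -> 'cV[R]_p} {k L : nat} (kL : (k <= L)%N)
    {u : 'I_L -> 'cV[R]_m} {y : 'I_L -> 'cV[R]_p} :
  io_behavior f g k (traj_col (leading kL u) (leading kL y)) ->
  exists x : nat -> 'cV[R]_n,
    (forall i : 'I_L, x i.+1 = f (x i) (u i)) /\
    (forall i : 'I_L, (i < k)%N -> y i = g (x i) (u i)).
Proof.
move=> /io_behavior_traj_colP[x0 x0P].
(* The input is padded with zeros to index it by all natural numbers. *)
pose v i := if insub i is Some j then u j else 0.
have vE (i : 'I_L) : v i = u i by rewrite /v valK.
pose x := fix x i := if i is j.+1 then f (x j) (v j) else x0 0%N.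
have x_x0 i : (i <= k)%N -> x i = x0 i.
  elim: i => [//|i IHi] lt_i_k /=.
  have [-> _] := x0P (Ordinal lt_i_k).
  by rewrite IHi 1?ltnW // -[leading _ _ _]vE.
exists x; split=> [i /=|i lt_i_k]; first by rewrite vE.
have [_] := x0P (Ordinal lt_i_k); rewrite /leading /=.
have -> : widen_ord kL (Ordinal lt_i_k) = i by exact: val_inj.
by rewrite x_x0 // ltnW.
Qed.

Theorem theorem1 (R : realType) (n m p nz : nat)
    (f : 'cV[R]_n -> 'cV[R]_m -> 'cV[R]_n)
    (g : 'cV[R]_n -> 'cV[R]_m -> 'cV[R]_p)
    (phi : 'I_nz -> 'cV[R]_n -> R)
    (A : 'M[R]_nz) (B : 'M[R]_(nz, m)) (C : 'M[R]_(p, nz)) (D : 'M[R]_(p, m))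
    (hK : koopman_linear_embedding f g phi A B C D) :
  (forall L : nat, (1 <= L)%N ->
     io_behavior f g L `<=` linear_behavior A B C D L) /\
  (forall (L : nat) (hL : (nz < L)%N)
      (u : 'I_L -> 'cV[R]_m) (y : 'I_L -> 'cV[R]_p),
     linear_behavior A B C D L (traj_col u y) ->
     (io_behavior f g L (traj_col u y) <->
      io_behavior f g nz
        (traj_col (leading (ltnW hL) u) (leading (ltnW hL) y)))).
Proof.
case: hK => _ Phi_f g_Phi; split=> [L _ w|L hL u y].
  move=> [u [y [-> [_ [x [_ xP]]]]]]; apply/io_behavior_traj_colP.
  exists (lift_map phi \o x) => k /=; have [-> ->] := xP k.
  by rewrite Phi_f g_Phi.
move=> /io_behavior_traj_colP[z zP]; split; first exact: io_behavior_leading.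
move=> /io_behavior_leading_extend[x [xS xy]].
pose d k : 'cV[R]_nz := lift_map phi (x k) - z k.
have dS k : (k < L)%N -> d k.+1 = A *m d k.
  move=> lt_k_L; rewrite /d (xS (Ordinal lt_k_L)) Phi_f.
  have [-> _] := zP (Ordinal lt_k_L).
  by rewrite mulmxBr opprD addrACA subrr addr0.
have outD (k : 'I_L) : g (x k) (u k) - y k = C *m d k.
  have [_ ->] := zP k.
  by rewrite g_Phi mulmxBr opprD addrACA subrr addr0.
have Cd0 k : (k < nz)%N -> C *m d k = 0.
  move=> lt_k_nz; have lt_k_L := ltn_trans lt_k_nz hL.
  by rewrite -(outD (Ordinal lt_k_L)) (xy (Ordinal lt_k_L)) // subrr.
apply/io_behavior_traj_colP; exists x => k; split; first exact: xS.
apply/esym/subr0_eq; rewrite outD.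
exact: (autonomous_output_eq0 (ltnW hL) dS Cd0 k (ltnW (ltn_ord k))).
Qed.
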